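(* Let $\langle K_f : f\in\mathbb{P}\rangle$ be an order-preserving cover of $2^{\omega_1}$ by compact sets, that is, each $K_f$ is a compact subset of $2^{\omega_1}$, $\bigcup_{f\in\mathbb{P}}K_f=2^{\omega_1}$, and $f\le g$ implies $K_f\subseteq K_g$ for all $f,g\in\mathbb{P}$. Then there is an $f\in\mathbb{P}$ such that $K_f$ is BIG.
   Context: $\mathbb{P}$ denotes the set $\omega^\omega$ of all functions $f:\omega\to\omega$, ordered coordinatewise: $f\le g$ means $f(n)\le g(n)$ for all $n\in\omega$. $2^{\omega_1}$ is the set of all functions $\omega_1\to 2=\{0,1\}$ with the product topology ($2$ discrete), where $\omega_1$ is the first uncountable ordinal. For $\delta\in\omega_1$ (a countable ordinal, identified with the set of smaller ordinals), $\pi_\delta: 2^{\omega_1}\to 2^{\omega_1\setminus\delta}$ is the projection (restriction) map $x\mapsto x\restriction(\omega_1\setminus\delta)$. A subset $Y$ of $2^{\omega_1}$ is BIG if it is compact and there is a $\delta\in\omega_1$ such that $\pi_\delta[Y]=2^{\omega_1\setminus\delta}$. *)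

(* Defs.v *)
From HB Require Import structures.
From mathcomp Require Import all_boot all_order.
From mathcomp Require Import all_classical wochoice.
From mathcomp Require Import topology.

Set Implicit Arguments.
Unset Strict Implicit.
Unset Printing Implicit Defensive.

Import Order.TTheory.
Local Open Scope classical_set_scope.
Local Open Scope card_scope.

(* [W] has order type omega_1: it is an uncountable well-order all of whose
   proper initial segments are countable. This determines [W] up to a unique
   order isomorphism; [omega1_exists] provides an instance. An element [delta]
   of [W] stands for the countable ordinal [[set alpha | alpha < delta]]. *)
Definition is_omega1 (d : Order.disp_t) (W : orderType d) : Prop :=
  [/\ well_order (<=%O : rel W),
      ~ countable [set: W]
    & forall delta : W, countable [set alpha : W | (alpha < delta)%O]].

(* The index set omega_1 \ delta: as [delta] is the set of smaller ordinals,
   its complement is the set of [alpha] with [delta <= alpha]. *)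
Definition tail (d : Order.disp_t) (W : orderType d) (delta : W) : Type :=
  {alpha : W | (delta <= alpha)%O}.

Definition proj_tail (d : Order.disp_t) (W : orderType d) (delta : W)
    (x : {ptws W -> bool}) : {ptws tail delta -> bool} :=
  fun alpha => x (sval alpha).
Arguments proj_tail {d W} delta x.

Definition big (d : Order.disp_t) (W : orderType d)
    (Y : set {ptws W -> bool}) : Prop :=
  compact Y /\
  exists delta : W, proj_tail delta @` Y = [set: {ptws tail delta -> bool}].

Lemma uncountable_set_nat : ~ countable [set: set nat].
Proof.
case/countable_injP => f finj.
pose D := [set n : nat | exists2 A : set nat, f A = n & ~ A n].
have [DfD|nDfD] := pselect (D (f D)).
  have [A fAD nA] := DfD; apply: nA.
  by rewrite (finj A D) ?inE.
by apply: (nDfD); exists D.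
Qed.

Lemma omega1_exists :
  exists (d : Order.disp_t) (W : orderType d), is_omega1 W.
Proof.
have [R Rwo] := well_ordering_principle (set nat : eqType).
have Rwo' : wo_chain R predT by apply: withinW.
have Rtot : total R by move=> x y; apply: (wo_chainW Rwo').
have Rrefl : reflexive R by move=> x; apply: (wo_chain_reflexive Rwo').
have Ranti : antisymmetric R.
  by move=> x y; apply: (wo_chain_antisymmetric Rwo').
have Rtrans : transitive R.
  move=> y x z xy yz.
  have ne : nonempty [pred t | t \in [:: x; y; z]].
    by exists x; rewrite !inE eqxx.
  have [m [[mA mlb] _]] := Rwo _ ne.
  have [mx my mz] : [/\ R m x, R m y & R m z].
    by split; apply: mlb; rewrite !inE eqxx ?orbT.
  move: mA; rewrite !inE => /or3P[] /eqP e; rewrite e in mx my mz => //.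
    by have -> : x = y by apply: Ranti; rewrite xy mx.
  by have <- : y = z by apply: Ranti; rewrite yz my.
pose seg (x : set nat) := [set y | R y x && (y != x)].
pose P : pred (set nat) := fun x => `[< countable (seg x) >].
pose W0 := {x : set nat | P x}.
pose le : rel W0 := fun x y => R (val x) (val y).
have le_refl : reflexive le by move=> x; apply: Rrefl.
have le_anti : antisymmetric le by move=> x y /Ranti/val_inj.
have le_trans : transitive le by move=> y x z; apply: Rtrans.
have le_tot : total le by move=> x y; apply: Rtot.
pose PO : porderType Order.default_display :=
  HB.pack W0 (@Order.Le_isPOrder.Build Order.default_display W0 le
    le_refl le_anti le_trans).
pose W : orderType Order.default_display :=
  HB.pack W0 PO (@Order.POrder_isTotal.Build Order.default_display PO le_tot).
exists Order.default_display, W; split.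
- apply: antisymmetric_well_order; first exact: le_anti.
  move=> A [a Aa].
  pose B : {pred set nat} := fun x =>
    `[< exists2 w : W0, val w = x & w \in A >].
  have [|m [[/asboolP[w wm wA] mlb] _]] := Rwo B.
    by exists (val a); apply/asboolP; exists a.
  exists w; split=> // x xA; change (R (val w) (val x)); rewrite wm.
  by apply: mlb; apply/asboolP; exists x.
- move=> cW.
  have cP : countable [set x | P x].
    have -> : [set x | P x] = (val : W0 -> set nat) @` setT.
      apply/seteqP; split=> [x Px|_ [x _ <-]]; last exact: (valP x).
      by exists (exist _ x Px).
    exact: (card_le_trans (card_image_le _ _) cW).
  have [x nPx] : exists x, ~~ P x.
    apply: contrapT => /forallNP h; apply: uncountable_set_nat.
    apply: sub_countable cP; apply: subset_card_le => x _.
    by apply/negPn/negP; exact: h.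
  have [|m [[nPm mlb] _]] := Rwo (fun x => ~~ P x); first by exists x.
  case/negP: nPm; apply/asboolP; apply: sub_countable cP.
  apply: subset_card_le => y /andP[ym ney]; apply/negPn/negP => nPy.
  by case/eqP: ney; apply: Ranti; rewrite ym; apply: mlb.
- move=> x; have /asboolP := valP (x : W0).
  rewrite /countable; apply: card_le_trans.
  have : (val : W0 -> set nat) @` [set y : W | (y < x)%O]
      #= [set y : W | (y < x)%O].
    by apply: inj_card_eq => y z _ _; apply: val_inj.
  rewrite card_eq_le => /andP[_ /card_le_trans]; apply.
  apply: subset_card_le => _ [y /= yx <-].
  by move: yx; rewrite lt_neqAle andbC.
Qed.

(* Main.v *)
Require Import Defs.
From mathcomp Require Import all_boot all_order.
From mathcomp Require Import all_classical.
From mathcomp Require Import topology.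
From mathcomp Require Import zify.

(** A compact subset of the Cantor cube is BIG as soon as it meets every basic
clopen set supported on some tail ([big_of_dense]), so the goal is one [f] such
that [K f] realizes all finite patterns on a tail of omega_1. The argument
depends on how the cardinal omega_1 sits with respect to the bounding number b
and the dominating number d of omega^omega.

If b > omega_1 ([big_of_bounded]): write K(s) for the union of the [K f] with
[f] extending the finite sequence [s]. A countable union that meets every
closed G_delta set of the form [p extends w], for [w] a countable partial
function above a given one, has a piece with the same property above some
larger countable partial function. Iterating gives a branch [x] and a countable
partial function [z] such that every K(x|n) meets every such set above [z].
Countably many points, the n-th one taken in K(x|n), lie in a common [K g],
because functions that agree with [x] up to n have a pointwise supremum; hence
for every gamma some [K (g gamma)] realizes all patterns below gamma. The
omega_1 many functions [g gamma] are bounded modulo finite by one [h], and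
uncountably many of them lie below [h + m] for the same [m].

If d = omega_1 ([big_of_dominating]): were no [K f] BIG, each would miss
finite patterns arbitrarily far out, and a recursion along omega_1 would glue
patterns with disjoint supports into a point that lies outside [K f] for a
cofinal set of [f]'s.

If b = omega_1 < d ([big_of_HFDw]): b = omega_1 yields a family of points
indexed by omega_1 (an HFD_w in the sense of Juhasz) all of whose uncountable
subfamilies contain a countable set that is dense on a tail
([osc_point_HFDw]); this is Todorcevic's oscillation technique. Choose f_xi
with the point x_xi in [K f_xi] and a branch [x] such that uncountably many
f_xi extend x|n, for all n; pick a countable dense set among the corresponding
points for each n. As d > omega_1, finitely many points from each of these sets
suffice to realize every pattern, and finitely many per level again lie in a
common [K g]. *)

Set Implicit Arguments.
Unset Strict Implicit.
Unset Printing Implicit Defensive.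

Import Order.TTheory.
Local Open Scope classical_set_scope.

(** * Dependent choices and branches of omega^(<omega) *)

Lemma iterated_choice (T : Type) (Inv : T -> Prop) (R : nat -> T -> T -> Prop)
    (t0 : T) : Inv t0 ->
  (forall n t, Inv t -> exists2 t', Inv t' & R n t t') ->
  exists u : nat -> T,
    [/\ u 0 = t0, forall n, Inv (u n) & forall n, R n (u n) (u n.+1)].
Proof.
move=> I0 step.
have /choice[F FP] : forall nt : nat * T, exists t',
    Inv nt.2 -> Inv t' /\ R nt.1 nt.2 t'.
  move=> [n t]; have [It|nIt] := pselect (Inv t); last by exists t => /nIt.
  by have [t' ? ?] := step n t It; exists t'.
pose u := fix u n := if n is m.+1 then F (m, u m) else t0.
have Iu n : Inv (u n) by elim: n => //= n In; have [] := FP (n, u n) In.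
by exists u; split=> // n; have [] := FP (n, u n) (Iu n).
Qed.

(** The side state [t] lets a branch be built together with an increasing chain
of approximations to another object. *)
Lemma tree_branch (S : Type) (P : seq nat -> S -> Prop) (R : S -> S -> Prop)
    (t0 : S) : P [::] t0 ->
  (forall s t, P s t -> exists m, exists2 t', P (rcons s m) t' & R t t') ->
  exists (x : nat -> nat) (u : nat -> S),
    forall n, P (mkseq x n) (u n) /\ R (u n) (u n.+1).
Proof.
move=> P0 step.
have [] := @iterated_choice (seq nat * S) (fun st => P st.1 st.2)
  (fun _ st st' => (exists m, st'.1 = rcons st.1 m) /\ R st.2 st'.2)
  ([::], t0) P0.
  move=> _ [s t] /= /step[m [t' Pt' Rt']]; exists (rcons s m, t') => //=.
  by split=> //; exists m.
move=> v [v0 vP vR].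
pose x n := last 0 (v n.+1).1.
have xE n : (v n).1 = mkseq x n.
  elim: n => [|n IHn]; first by rewrite v0.
  have [[m vm] _] := vR n; rewrite mkseqS -IHn /x vm last_rcons //.
exists x, (fun n => (v n).2) => n; rewrite -xE; split; first exact: vP.
by have [] := vR n.
Qed.

(** * The first uncountable ordinal *)

Section Omega1.
Context (d : Order.disp_t) (W : orderType d) (hW : is_omega1 W).
Implicit Types (alpha gamma delta : W) (A : set W).

Lemma lt_omega1_wf : well_founded (fun alpha gamma => (alpha < gamma)%O).
Proof.
move=> gamma; apply: contrapT => nacc.
have [wo _ _] := hW.
pose B : {pred W} := fun alpha => `[< ~ Acc (fun x y : W => (x < y)%O) alpha >].
have [|m [[/asboolP nm mlb] _]] := wo B; first by exists gamma; apply/asboolP.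
apply: nm; constructor=> y ym; apply: contrapT => ny.
by have := mlb y (asboolT ny); rewrite leNgt ym.
Qed.

Lemma uncountable_cofinal A :
  ~ countable A -> forall gamma, exists2 alpha, A alpha & (gamma <= alpha)%O.
Proof.
move=> nA gamma; apply: contrapT => h; apply: nA.
have [_ _ /(_ gamma)] := hW; apply: sub_countable.
apply: subset_card_le => alpha Aa /=; rewrite ltNge; apply/negP => ga.
by apply: h; exists alpha.
Qed.

Lemma sequence_bounded (u : nat -> W) : exists delta, forall n, (u n < delta)%O.
Proof.
apply: contrapT => /forallNP h; have [_ nW segW] := hW; apply: nW.
have -> : [set: W] = \bigcup_(n in [set: nat])
    ([set alpha | (alpha < u n)%O] `|` [set u n]).
  apply/seteqP; split=> // alpha _.
  have /existsNP[n /negP] := h alpha; rewrite -leNgt le_eqVlt.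
  by case/orP=> [/eqP -> | ua]; exists n => //; [right|left].
apply: bigcup_countable => // n _; rewrite setUC.
have -> : [set u n] `|` [set alpha | (alpha < u n)%O] =
    \bigcup_(b in [set: bool]) (if b then [set u n] else [set alpha | (alpha < u n)%O]).
  by apply/seteqP; split=> [x [] ? | x [[] _ ?]]; [exists true|exists false|left|right].
by apply: bigcup_countable => // -[] _; [exact: countable1|exact: segW].
Qed.

Lemma list_bounded delta (a : seq W) :
  exists2 gamma, (delta < gamma)%O & {in a, forall alpha, (alpha < gamma)%O}.
Proof.
have [gamma h] := sequence_bounded (nth delta (delta :: a)).
exists gamma; first exact: (h 0).
by move=> alpha aa; have := h (index alpha a).+1; rewrite /= nth_index.
Qed.

Lemma segment_enumeration gamma :
  exists E : nat -> W, forall alpha, (alpha < gamma)%O -> exists n, E n = alpha.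
Proof.
have [_ _ /(_ gamma) /countable_injP[f finj]] := hW.
exists (fun n => xget gamma [set alpha | (alpha < gamma)%O /\ f alpha = n]).
move=> alpha ag; exists (f alpha).
case: xgetP => [y -> [yg fy]|/(_ alpha)]; last by case.
by apply: finj; rewrite ?inE.
Qed.

Lemma uncountable_piece (I : countType) A (B : I -> set W) :
  ~ countable A -> (forall alpha, A alpha -> exists i, B i alpha) ->
  exists i, ~ countable (A `&` B i).
Proof.
move=> nA AB; apply: contrapT => /forallNP h; apply: nA.
apply: (@sub_countable _ _ _ (\bigcup_(i in [set: I]) (A `&` B i))).
  by apply: subset_card_le => x Ax; have [i Bi] := AB x Ax; exists i.
by apply: bigcup_countable => // i _; apply: contrapT => /(h i).
Qed.

(** Recursion along omega_1. The hypothesis is stated for total [h], although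
the construction at [gamma] only controls its values below [gamma], so that
callers can bound or enumerate the values of [h] without restricting it. *)
Lemma transfinite_choice (T : Type) (t0 : T) (S : W -> T -> Prop)
    (R : T -> T -> Prop) :
  (forall gamma (h : W -> T), exists2 t, S gamma t &
     forall alpha, (alpha < gamma)%O -> R (h alpha) t) ->
  exists h : W -> T, forall gamma, S gamma (h gamma) /\
    forall alpha, (alpha < gamma)%O -> R (h alpha) (h gamma).
Proof.
move=> step.
have /choice[F FP] : forall gh : W * (W -> T), exists t, S gh.1 t /\
    forall alpha, (alpha < gh.1)%O -> R (gh.2 alpha) t.
  by move=> [g h]; have [t] := step g h; exists t.
pose body gamma (rec : forall alpha, (alpha < gamma)%O -> T) : T :=
  F (gamma, fun alpha => if pselect (alpha < gamma)%O is left p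
                         then rec alpha p else t0).
pose h := Fix lt_omega1_wf (fun=> T) body.
have hE gamma : h gamma =
    F (gamma, fun alpha => if (alpha < gamma)%O then h alpha else t0).
  rewrite /h Fix_eq; last first.
    move=> x f g fg; congr (F (_, _)); apply/funext => y.
    by case: pselect => // p; rewrite fg.
  congr (F (_, _)); apply/funext => y.
  by case: pselect => p; rewrite ?p //; case: ifPn => // /p.
exists h => gamma; rewrite hE.
have [Sg Rg] := FP (gamma, fun alpha => if (alpha < gamma)%O then h alpha else t0).
by split=> // alpha ag; have := Rg alpha ag; rewrite /= ag.
Qed.

Lemma coherent_limit (delta : nat -> W) (z : nat -> W -> bool) :
  (forall n, (delta n <= delta n.+1)%O) ->
  (forall n alpha, (alpha < delta n)%O -> z n.+1 alpha = z n alpha) ->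
  exists w : W -> bool, forall n alpha, (alpha < delta n)%O -> w alpha = z n alpha.
Proof.
move=> dS zS.
have dle : {homo delta : m n / (m <= n)%N >-> (m <= n)%O}.
  by apply: homo_leq => // y x t; apply: le_trans.
have zle m n alpha : (m <= n)%N -> (alpha < delta m)%O -> z n alpha = z m alpha.
  move=> /subnK <-; elim: (n - m) => //= k IHk am.
  by rewrite addSn zS ?IHk //; apply: lt_le_trans am (dle _ _ (leq_addl _ _)).
exists (fun alpha => z (xget 0 [set n | (alpha < delta n)%O]) alpha) => n alpha an.
case: xgetP => [m _ am|/(_ n)] //.
by have [mn|/ltnW nm] := leqP m n; [rewrite (zle m n)|rewrite (zle n m)].
Qed.

(** The trace of [Y] on the tail is compact and dense there. Compactness is used
directly: the points of [Y] that agree with a target on finitely many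
coordinates form a filter base on [Y], and any cluster point of it projects to
the target. *)
Lemma big_of_dense (Y : set {ptws W -> bool}) delta : compact Y ->
  (forall (a : seq W) (e : W -> bool),
     {in a, forall alpha, (delta <= alpha)%O} ->
     exists2 p, Y p & {in a, p =1 e}) ->
  big Y.
Proof.
move=> cY dense; split=> //; exists delta; apply/seteqP; split=> // w _.
pose e alpha := if pselect (delta <= alpha)%O is left h
                then w (exist _ alpha h) else false.
pose C (a : seq W) : set {ptws W -> bool} :=
  [set p | Y p /\ {in [seq alpha <- a | (delta <= alpha)%O], p =1 e}].
have FP : ProperFilter (filter_from [set: seq W] C).
  apply: filter_from_proper.
    apply: filter_from_filter; first by exists [::].
    move=> a b _ _; exists (a ++ b) => // p [Yp]; rewrite filter_cat => pe.
    by split; split=> // x xa; apply: pe; rewrite mem_cat xa ?orbT.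
  move=> a _; have [x|p Yp pe] := dense [seq alpha <- a | (delta <= alpha)%O] e.
    by rewrite mem_filter => /andP[].
  by exists p.
have FY : filter_from [set: seq W] C Y by exists [::] => // p [].
have [p [Yp cp]] := cY _ FP FY.
exists p => //; apply/funext => -[alpha da]; rewrite /proj_tail /=.
have nb : nbhs p [set q : {ptws W -> bool} | q alpha = p alpha].
  have := @proj_continuous W (fun=> bool) alpha p.
  by move=> /(_ [set p alpha]); apply; exact: discrete_set1.
have [|q [[_ qe] <-]] := cp (C [:: alpha]) _ _ nb; first by exists [:: alpha].
rewrite qe; last by rewrite /= da mem_head.
rewrite /e; case: pselect => // h; congr (w (exist _ _ _)).
exact: bool_irrelevance.
Qed.

(** Every uncountable subfamily of [X] has a countable part that is dense in the
cube over some tail; in the terminology of Juhasz, [X] is an HFD_w. *)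
Definition HFDw (X : W -> W -> bool) : Prop :=
  forall A, ~ countable A ->
  exists (s : nat -> W) delta, (forall i, A (s i)) /\
    forall (a : seq W) (e : W -> bool), {in a, forall alpha, (delta <= alpha)%O} ->
    exists i, {in a, X (s i) =1 e}.

End Omega1.

(** * Eventual domination *)

Definition eventually_le (f g : nat -> nat) : Prop :=
  exists N, forall n, (N <= n)%N -> (f n <= g n)%N.

Lemma countable_dominated (I : countType) (u : I -> nat -> nat) :
  exists g, forall i, eventually_le (u i) g.
Proof.
exists (fun n => \max_(k < n.+1) if unpickle k is Some i then u i n else 0).
move=> i; exists (pickle i) => n ni.
have ni' : (pickle i < n.+1)%N by [].
apply: leq_trans (leq_bigmax (Ordinal ni')) => /=; by rewrite pickleK.
Qed.

(** Functions that follow [x] for longer and longer have a pointwise supremum: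
at a coordinate [i] only the finitely many with [n <= i] can differ from
[x i]. This is what turns points of the sets K(x|n) into points of a single
[K g]. *)
Lemma diagonal_bound (x h : nat -> nat) (f : nat -> nat -> nat -> nat) :
  (forall n k i, (i < n)%N -> f n k i = x i) ->
  exists g : nat -> nat, forall n k, (k <= h n)%N -> forall i, (f n k i <= g i)%N.
Proof.
move=> fx.
exists (fun i => maxn (x i) (\max_(n < i.+1) \max_(k < (h n).+1) f n k i)).
move=> n k kh i; rewrite leq_max; case: (ltnP i n) => [/fx ->|ni].
  by rewrite leqnn.
apply/orP; right; have ni' : (n < i.+1)%N by [].
apply: leq_trans (leq_bigmax (Ordinal ni')) => /=.
have kh' : (k < (h n).+1)%N by [].
exact: leq_trans (leq_bigmax (Ordinal kh')).
Qed.

Lemma eventually_all (T : eqType) (a : seq T) (P : T -> nat -> Prop) :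
  {in a, forall t, exists N, forall n, (N <= n)%N -> P t n} ->
  exists N, {in a, forall t n, (N <= n)%N -> P t n}.
Proof.
elim: a => [_|t a IHa h]; first by exists 0.
have [N1 h1] := h t (mem_head _ _).
have [x xa|N2 h2] := IHa; first by apply: h; rewrite inE xa orbT.
exists (maxn N1 N2) => x; rewrite inE => xa n; rewrite geq_max => /andP[n1 n2].
case/predU1P: xa => [->|xa].
  exact: h1.
exact: h2.
Qed.

(** * Oscillations *)

Definition crossing (f g : nat -> nat) (i : nat) : bool :=
  (g i < f i)%N && (f i.+1 <= g i.+1)%N.

(** The number of downward crossings of [g] by [f]. It makes sense when [f] is
eventually below [g], as no crossing occurs after that point ([oscE]). *)
Definition osc (f g : nat -> nat) : nat :=
  count (crossing f g)
    (iota 0 (xget 0 [set N | forall n, (N <= n)%N -> (f n <= g n)%N])).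

Lemma no_crossing (f g : nat -> nat) m n :
  (forall i, (m <= i < n)%N -> ~~ crossing f g i) ->
  count (crossing f g) (iota m (n - m)) = 0.
Proof.
move=> h; rewrite (@eq_in_count _ _ pred0) ?count_pred0 // => i.
by rewrite mem_iota => ?; apply/negbTE/h; lia.
Qed.

Lemma oscE (f g : nat -> nat) N : (forall n, (N <= n)%N -> (f n <= g n)%N) ->
  osc f g = count (crossing f g) (iota 0 N).
Proof.
have stable m n : (forall i, (m <= i)%N -> (f i <= g i)%N) -> (m <= n)%N ->
    count (crossing f g) (iota 0 n) = count (crossing f g) (iota 0 m).
  move=> fg mn; rewrite -(subnKC mn) iotaD count_cat no_crossing ?addn0 //.
  by move=> i /andP[mi _]; rewrite /crossing ltnNge fg.
move=> fN; rewrite /osc; case: xgetP => [m _ fm|/(_ N)//].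
by have [mN|/ltnW Nm] := leqP m N; [rewrite (stable m N)|rewrite (stable N m)].
Qed.

(** Before [m] the functions [f] and [f'] cross [g] in the same way; then [f']
stays below [g] until [k], jumps above it, and returns for good at [p], which
adds the single crossing at [p.-1]. *)
Lemma osc_succ (f f' g : nat -> nat) m n k p :
  (forall i, (m <= i)%N -> (f i <= g i)%N) ->
  (m < n <= k)%N -> (k < p)%N ->
  (forall i, (i < n)%N -> f' i = f i) ->
  (forall i, (n <= i < k)%N -> (f' i <= g i)%N) ->
  (forall i, (k <= i < p)%N -> (g i < f' i)%N) ->
  (forall i, (p <= i)%N -> (f' i <= g i)%N) ->
  osc f' g = (osc f g).+1.
Proof.
move=> fg /andP[mn nk] kp ff' below above after.
rewrite (oscE fg) (oscE after).
have -> : p = (m + (p.-1 - m) + 1)%N by lia.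
rewrite !iotaD !count_cat /= add0n.
rewrite (@eq_in_count _ _ (crossing f g)); last first.
  move=> i; rewrite mem_iota => im.
  by rewrite /crossing !ff' //; lia.
rewrite no_crossing; last first.
  move=> i im; have [ik|ki] := ltnP i k.
    have : (f' i <= g i)%N.
      by have [/[dup] ? /ff' ->|ni] := ltnP i n; [apply: fg|apply: below]; lia.
    by rewrite /crossing ltnNge => ->.
  have : (g i.+1 < f' i.+1)%N by apply: above; lia.
  by rewrite /crossing ltnNge andbC => /negbTE ->.
have -> : (m + (p.-1 - m))%N = p.-1 by lia.
have -> : crossing f' g p.-1.
  rewrite /crossing above; last by lia.
  by rewrite after //; lia.
by rewrite addn0 addn1.
Qed.

(** Each element of [s] can spoil at most one of the consecutive intervals cut
out by the iterates of [H], so one of the first [(size s).+1] is free. *)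
Lemma gap (H : nat -> nat) : (forall l, (l <= H l)%N) ->
  forall (s : seq nat) q, exists2 l, (q <= l)%N &
    (H l <= iter (size s).+1 H q)%N /\ {in s, forall x, ~~ (l <= x < H l)%N}.
Proof.
move=> Hl; have iterle m n q : (m <= n)%N -> (iter m H q <= iter n H q)%N.
  move=> /subnK <-; elim: (n - m) => //= j IHj.
  by apply: leq_trans IHj _; exact: Hl.
move=> s; have [N] := ubnP (size s); elim: N s => // N IHN s sN q.
have [/hasP[x xs xq]|/hasPn nos] := boolP (has (fun x => (q <= x < H q)%N) s).
  have ss : size s = (size (rem x s)).+1.
    by rewrite size_rem // prednK // -has_predT; apply/hasP; exists x.
  have [|l Hql [Hle nol]] := IHN (rem x s) _ (H q); first by rewrite -ltnS -ss.
  exists l; first exact: leq_trans (Hl q) Hql.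
  split; first by rewrite ss iterSr.
  move=> y ys; have [->|yx] := eqVneq y x; first by lia.
  by apply: nol; move: ys; rewrite (perm_mem (perm_to_rem xs)) inE (negbTE yx).
exists q => //; split=> //.
exact: (iterle 1 (size s).+1 q).
Qed.

(** * A family with small uncountable density, from an unbounded family *)

Section Scale.
Context (d : Order.disp_t) (W : orderType d) (hW : is_omega1 W).
Implicit Types (alpha gamma delta : W) (A : set W).

(** The sums make the functions nondecreasing, and strictness of the eventual
order makes them pairwise distinct. *)
Lemma unbounded_scale (u : W -> nat -> nat) :
  (forall g, exists gamma, ~ eventually_le (u gamma) g) ->
  exists b : W -> nat -> nat,
    [/\ forall gamma, {homo b gamma : m n / (m <= n)%N},
        forall alpha gamma, (alpha < gamma)%O ->
          eventually_le (fun n => (b alpha n).+1) (b gamma)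
      & forall g, exists gamma, ~ eventually_le (b gamma) g].
Proof.
move=> uunb.
have [gamma h|b bP] := @transfinite_choice d W hW (nat -> nat) id
  (fun gamma t => {homo t : m n / (m <= n)%N} /\ eventually_le (u gamma) t)
  (fun t t' => eventually_le (fun n => (t n).+1) t').
  have [E EP] := segment_enumeration hW gamma.
  have [g gP] := @countable_dominated (option nat)
    (fun o n => if o is Some i then (h (E i) n).+1 else u gamma n).
  have gle n : (g n <= \sum_(i < n.+1) g i)%N.
    by rewrite big_ord_recr /= leq_addl.
  exists (fun n => \sum_(i < n.+1) g i); first split.
  - apply: homo_leq => [//|y x z|n]; first exact: leq_trans.
    by rewrite [leqRHS]big_ord_recr /= leq_addr.
  - have [N gN] := gP None; exists N => n /gN /leq_trans; exact.
  - move=> alpha /EP[i <-]; have [N gN] := gP (Some i).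
    by exists N => n /gN /leq_trans; exact.
exists b; split=> [gamma|alpha gamma ag|g].
- by have [[]] := bP gamma.
- by have [_ h] := bP gamma; apply: h.
- have [gamma ng] := uunb g; exists gamma => -[N bg]; apply: ng.
  have [[_ [M uM]] _] := bP gamma; exists (maxn M N) => n.
  by rewrite geq_max => /andP[Mn Nn]; apply: leq_trans (uM n Mn) (bg n Nn).
Qed.

Context (b : W -> nat -> nat).
Context (bmono : forall gamma, {homo b gamma : m n / (m <= n)%N}).
Context (blt : forall alpha gamma, (alpha < gamma)%O ->
  eventually_le (fun n => (b alpha n).+1) (b gamma)).
Context (bunb : forall g, exists gamma, ~ eventually_le (b gamma) g).

Lemma scale_le alpha gamma : (alpha <= gamma)%O -> eventually_le (b alpha) (b gamma).
Proof.
rewrite le_eqVlt => /predU1P[->|/blt[N h]]; first by exists 0.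
by exists N => n /h /ltnW.
Qed.

Lemma uncountable_unbounded A : ~ countable A ->
  exists k, forall l, exists2 alpha, A alpha & (l <= b alpha k)%N.
Proof.
move=> nA; apply: contrapT => /forallNP h.
have /choice[g gP] : forall k, exists l, forall alpha, A alpha -> (b alpha k < l)%N.
  move=> k; have /existsNP[l nl] := h k; exists l => alpha Aa.
  by rewrite ltnNge; apply/negP => la; apply: nl; exists alpha.
have [gamma []] := bunb g; have [alpha Aa ga] := uncountable_cofinal hW nA gamma.
have [N Nga] := scale_le ga; exists N => n /Nga /leq_trans; apply.
exact/ltnW/gP.
Qed.

(** The tree of initial segments of the functions [b (s j)] splits infinitely
above each of its nodes. The bound [r] is uniform in the size [l] of the jump
at [k]: it must be known before the functions to be jumped over are given. *)
Definition splitting (s : nat -> W) : Prop :=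
  forall i n, exists k r, (n <= k)%N /\ forall l, exists j,
    [/\ forall m, (m < n)%N -> b (s j) m = b (s i) m,
        forall m, (m < k)%N -> (b (s j) m <= r)%N
      & (l <= b (s j) k)%N].

(** After removing the countably many members of [A] that lie in a node with
countable trace, every node has an unbounded trace; the least coordinate at
which it is unbounded is the splitting level [k], and there are common bounds
below it. One member of the trace per node gives the countable set. *)
Lemma splitting_sequence A : ~ countable A ->
  exists2 s : nat -> W, forall i, A (s i) & splitting s.
Proof.
move=> nA.
pose node (t : seq nat) := [set alpha | mkseq (b alpha) (size t) = t].
have nodeP alpha n : node (mkseq (b alpha) n) alpha by rewrite /node /= size_mkseq.
have nodeE alpha gamma n m : (m < n)%N ->
    node (mkseq (b alpha) n) gamma -> b gamma m = b alpha m.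
  move=> mn; rewrite /node /= size_mkseq => /(congr1 (fun t => nth 0 t m)).
  by rewrite !nth_mkseq.
pose small := \bigcup_(t in [set t | countable (A `&` node t)]) (A `&` node t).
have csmall : countable small.
  by apply: bigcup_countable => //.
pose A' := A `\` small.
have big_node alpha n : A' alpha -> ~ countable (A' `&` node (mkseq (b alpha) n)).
  move=> [Aa nsa] c; apply: nsa; exists (mkseq (b alpha) n) => //=.
  have : countable ((A' `&` node (mkseq (b alpha) n)) `|` small).
    by rewrite -bigcup2E; apply: bigcup_countable => // -[|[|i]] _ /=.
  apply: sub_countable; apply: subset_card_le => x [Ax nx].
  by have [sx|nsx] := pselect (small x); [right|left].
have [a0 A'a0] : exists a0, A' a0.
  apply: contrapT => /forallNP nA'; apply: nA; apply: sub_countable csmall.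
  apply: subset_card_le => x Ax; apply: contrapT => nsx; exact: (nA' x).
pose s k := if unpickle k is Some t then
  (if pselect (exists x, A' x /\ node t x) is left ex then projT1 (cid ex) else a0)
  else a0.
have sA' k : A' (s k).
  rewrite /s; case: unpickle => // t; case: pselect => // ex.
  by case: cid => x [].
have sdense alpha n : A' alpha -> exists j, node (mkseq (b alpha) n) (s j).
  move=> A'a; exists (pickle (mkseq (b alpha) n)); rewrite /s pickleK.
  case: pselect => [ex|[]]; last by exists alpha.
  by case: cid => x [].
exists s => [i|i n]; first by have [] := sA' i.
pose B := A' `&` node (mkseq (b (s i)) n).
have ub := uncountable_unbounded (big_node (s i) n (sA' i)).
pose unb k := `[< forall l, exists2 alpha, B alpha & (l <= b alpha k)%N >].
have exk : exists k, unb k by have [k kP] := ub; exists k; apply/asboolP.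
have [k /asboolP kunb kmin] := ex_minnP exk.
have [r rP] : exists r, forall m, (m < k)%N ->
    forall alpha, B alpha -> (b alpha m <= r)%N.
  have /choice[g gP] : forall m, exists l, (m < k)%N ->
      forall alpha, B alpha -> (b alpha m <= l)%N.
    move=> m; case: (ltnP m k) => [mk|km]; last by exists 0.
    apply: contrapT => /forallNP h.
    suff /kmin : unb m by rewrite leqNgt mk.
    apply/asboolP => l; have /not_implyP[_ /existsNP[alpha /not_implyP[Ba]]] := h l.
    by move=> /negP; rewrite -ltnNge => /ltnW; exists alpha.
  exists (\max_(m < k) g m) => m mk alpha Ba.
  exact: leq_trans (gP m mk alpha Ba) (leq_bigmax (Ordinal mk)).
have nk : (n <= k)%N.
  rewrite leqNgt; apply/negP => kn.
  have [alpha [_ nalpha]] := kunb (b (s i) k).+1.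
  by rewrite (nodeE _ _ _ _ kn nalpha) ltnn.
exists k, r; split=> // l.
have [alpha [A'a nalpha] la] := kunb l.
have [j nj] := sdense alpha k.+1 A'a; exists j.
split=> [m mn|m mk|].
- rewrite (nodeE _ _ _ _ _ nj); last by lia.
  exact: nodeE nalpha.
- by rewrite (nodeE _ _ _ _ _ nj) ?rP //; lia.
- by rewrite (nodeE _ _ _ _ _ nj).
Qed.

(** The heart of the oscillation argument. Starting from [b (s i)], follow it
up to a level [n] beyond which it is below all the [b alpha], go on to a
splitting level [k] while staying below them, and jump there to a value
[>= l]. The new function is eventually below [b delta0], from a place that
depends on [l] but not on [a]; this defines [H]. If no value of any [b alpha]
lies between [l] and [H l], then each [b alpha] passes from below [l] to above
[H l] in one step, hence overtakes the new function exactly once after [k].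
Such an [l] exists by the pigeonhole lemma [gap], because some [b delta1] escapes
the function [G] that dominates sufficiently many iterates of [H], and so do
all the [b alpha] with it, at the same arguments. *)
Lemma osc_step (s : nat -> W) : splitting s ->
  exists delta, forall a : seq W, {in a, forall alpha, (delta <= alpha)%O} ->
    forall i, exists j,
    {in a, forall alpha, osc (b (s j)) (b alpha) = (osc (b (s i)) (b alpha)).+1}.
Proof.
move=> split_s.
have [delta0 sd0] := sequence_bounded hW s.
have /choice[K KP] : forall t : nat * nat, exists kr : nat * nat,
    (t.2 <= kr.1)%N /\ forall l, exists j,
    [/\ forall m, (m < t.2)%N -> b (s j) m = b (s t.1) m,
        forall m, (m < kr.1)%N -> (b (s j) m <= kr.2)%N
      & (l <= b (s j) kr.1)%N].
  by move=> [i n]; have [k [r h]] := split_s i n; exists (k, r).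
have /choice[J JP] : forall t : (nat * nat) * nat, exists j,
    [/\ forall m, (m < t.1.2)%N -> b (s j) m = b (s t.1.1) m,
        forall m, (m < (K t.1).1)%N -> (b (s j) m <= (K t.1).2)%N
      & (t.2 <= b (s j) (K t.1).1)%N].
  by move=> [t l]; have [_ /(_ l)] := KP t.
have /choice[M MP] : forall j, exists m, forall n, (m <= n)%N ->
    (b (s j) n <= b delta0 n)%N.
  by move=> j; apply: scale_le; apply/ltW.
pose H t l := maxn l.+1 (b (s (J (t, l))) (maxn (M (J (t, l))) l)).
have Hle t l : (l <= H t l)%N by rewrite leq_max leqnSn.
have iterle t m n q : (m <= n)%N -> (iter m (H t) q <= iter n (H t) q)%N.
  move=> /subnK <-; elim: (n - m) => //= j IHj.
  by apply: leq_trans IHj _; exact: Hle.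
have [G GP] := @countable_dominated (nat * nat)%type
  (fun t q => maxn (iter (q * q).+1 (H t) q) (K (t.1, q)).2).
have [delta1 nd1] := bunb G.
exists (Order.max delta0 delta1) => a ad i.
(* [N0] is a place from which all the eventual inequalities between the
   functions at hand are true. *)
have [N0 N0P] : exists N, {in a, forall alpha n, (N <= n)%N ->
    [/\ b delta0 n <= b alpha n, b delta1 n <= b alpha n
      & b (s i) n <= b alpha n]%N}.
  apply: eventually_all => alpha /ad; rewrite ge_max => /andP[d0 d1].
  have [m0 h0] := scale_le d0; have [m1 h1] := scale_le d1.
  have [|m2 h2] := @scale_le (s i) alpha.
    by apply: le_trans d0; exact/ltW.
  by exists (maxn m0 (maxn m1 m2)) => n; rewrite !geq_max => /and3P[? ? ?]; split; auto.
have often N : exists2 q, (N <= q)%N & (G q < b delta1 q)%N.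
  apply: contrapT => h; apply: nd1; exists N => n Nn.
  by rewrite leqNgt; apply/negP => ?; apply: h; exists n.
(* The second component of the dominated functions does not mention [t.2], so
   any index [(i, _)] bounds [r] at the level [n] still to be chosen. *)
have [N1 N1P] := GP (i, 0).
have [n nN Gn] := often (maxn N0 N1).+1.
have [N2 N2P] := GP (i, n).
pose k := (K (i, n)).1.
have [N3 N3P] : exists N, {in a, forall alpha q, (N <= q)%N -> (b alpha k < q)%N}.
  by apply: eventually_all => alpha _; exists (b alpha k).+1.
have [q qN Gq] := often (maxn (maxn N0 N2) (maxn N3 (size a))).
pose vals := [seq b alpha p | alpha <- a, p <- iota 0 q].
have svals : (size vals <= q * q)%N.
  by rewrite size_allpairs size_iota leq_mul2r; apply/orP; right; lia.
(* There are at most [q * q] values at arguments below [q], and at [q] all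
   functions are already above [H l]. *)
have [l ql [Hl nol]] := gap (Hle (i, n)) vals q.
have HG : (H (i, n) l <= G q)%N.
  have := N2P q; rewrite geq_max => /(_ _)/andP[]; first by lia.
  by move=> h _; apply: leq_trans h; apply: leq_trans Hl (iterle _ _ _ _ _).
pose j := J ((i, n), l).
exists j => alpha aa.
have [jn jk jl] := JP ((i, n), l); rewrite -/j /= -/k in jn jk jl.
have [nk _] := KP (i, n); rewrite -/k /= in nk.
have N0a m : (N0 <= m)%N -> [/\ b delta0 m <= b alpha m, b delta1 m <= b alpha m
      & b (s i) m <= b alpha m]%N by move=> /N0P; apply.
have exp : exists p, (l <= b alpha p)%N.
  exists q; have [|_ h _] := N0a q; first by lia.
  by have := Hle (i, n) l; lia.
have [p lp pmin] := ex_minnP exp.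
have before m : (m < p)%N -> (b alpha m < l)%N.
  by rewrite !ltnNge; apply: contra => /pmin.
have kp : (k < p)%N.
  rewrite ltnNge; apply/negP => pk.
  have := N3P _ aa q; have := bmono alpha pk; lia.
have jump : (H (i, n) l <= b alpha p)%N.
  have [pq|qp] := ltnP p q.
    have /nol : b alpha p \in vals.
      by apply/allpairsP; exists (alpha, p); rewrite mem_iota.
    by rewrite lp /= -leqNgt.
  have [|_ h _] := N0a q; first by lia.
  by have := bmono alpha qp; lia.
apply: (@osc_succ _ _ _ N0 n k p) => //.
- by move=> m /N0a[].
- by lia.
- move=> m /andP[nm mk]; apply: leq_trans (jk m mk) _.
  have [|_ h _] := N0a n; first by lia.
  have := bmono alpha nm; have := N1P n.
  rewrite geq_max => /(_ _)/andP[]; first by lia.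
  by move=> _ /=; lia.
- move=> m /andP[km /before mp]; have := bmono (s j) km; lia.
- move=> m pm; have [ml|lm] := leqP m (maxn (M j) l).
    apply: leq_trans (bmono (s j) ml) _.
    apply: leq_trans (bmono alpha pm); apply: leq_trans jump.
    by rewrite leq_max leqnn orbT.
  apply: leq_trans (MP j m _) _; first by lia.
  by have [] := N0a m; first by lia.
Qed.

Lemma separating_length (a : seq W) : exists n, {in a &, forall alpha gamma,
  mkseq (b alpha) n = mkseq (b gamma) n -> alpha = gamma}.
Proof.
have [n nP] : exists N, {in [seq (alpha, gamma) | alpha <- a, gamma <- a],
    forall t n, (N <= n)%N -> mkseq (b t.1) n = mkseq (b t.2) n -> t.1 = t.2}.
  apply: eventually_all => -[alpha gamma] _ /=.
  wlog ag : alpha gamma / (alpha < gamma)%O => [h|].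
    have [/h//|/h[N hN]|->] := ltgtP alpha gamma; last by exists 0.
    by exists N => n Nn /esym/(hN _ Nn).
  have [N hN] := blt ag; exists N.+1 => n Nn /(congr1 (fun t => nth 0 t N)).
  by rewrite !nth_mkseq //; have := hN N (leqnn _); lia.
exists n => alpha gamma aa ga; apply: (nP (alpha, gamma)) => //.
by apply/allpairsP; exists (alpha, gamma).
Qed.

(** A sequence in which every finite list of nodes occurs on arbitrarily long
intervals: it is constant on the intervals [[2 ^ k, 2 ^ k.+1[], with a value
coded by the 2-adic valuation of [k], which takes each value for arbitrarily
large [k]. *)
Definition block_code (n : nat) : seq (seq nat) :=
  odflt [::] (unpickle (logn 2 (trunc_log 2 n))).

Lemma block_codeP (c : seq (seq nat)) len :
  exists j, forall i, (i < len)%N -> block_code (j + i) = c.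
Proof.
pose k := (2 ^ pickle c * (len.*2).+1)%N.
exists (2 ^ k)%N => i ilen.
have lenk : (len <= k)%N.
  have : (0 < 2 ^ pickle c)%N by rewrite expn_gt0.
  by rewrite /k; nia.
have k2 : (k < 2 ^ k)%N by apply: ltn_expl.
have -> : block_code (2 ^ k + i) = odflt [::] (unpickle (logn 2 k)).
  rewrite /block_code (@trunc_log_eq 2 k) //.
  by rewrite expnS; lia.
suff -> : logn 2 k = pickle c by rewrite pickleK.
rewrite /k; move: (pickle c) => m; rewrite lognM ?expn_gt0 // pfactorK //.
by rewrite lognE dvdn2 /= odd_double /= addn0.
Qed.

(** The oscillation selects a clopen subset of omega^omega, given as a list of
nodes, and the coordinate [alpha] records whether [b alpha] belongs to it. *)
Definition osc_point (xi alpha : W) : bool :=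
  has (fun t => mkseq (b alpha) (size t) == t) (block_code (osc (b xi) (b alpha))).

(** Let [c] describe a clopen set that separates the [b alpha] with [e alpha]
from the others. By [osc_step] the oscillations with all [b alpha] can be
increased simultaneously by the same amount; their differences stay bounded,
so they can all be brought into a long block on which the code is [c]. *)
Lemma osc_point_HFDw : HFDw osc_point.
Proof.
move=> A nA; have [s sA /osc_step[delta step]] := splitting_sequence nA.
exists s, delta; split=> // a e ad.
have [n nP] := separating_length a.
pose o alpha := osc (b (s 0)) (b alpha).
pose c := [seq mkseq (b alpha) n | alpha <- a & e alpha].
have [j jP] := block_codeP c (\max_(alpha <- a) o alpha).+1.
have [i iP] : exists i, {in a, forall alpha,
    osc (b (s i)) (b alpha) = (j + o alpha)%N}.
  elim: (j) => [|m [i IHm]]; first by exists 0.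
  have [i' i'P] := step a ad i; exists i' => alpha aa.
  by rewrite i'P // IHm.
exists i => alpha aa; rewrite /osc_point iP // jP; last first.
  by rewrite ltnS; apply: leq_bigmax_seq.
apply/hasP/idP => [[t /mapP[gamma]]|ea].
  rewrite mem_filter => /andP[eg ga] ->; rewrite size_mkseq => /eqP/nP -> //.
exists (mkseq (b alpha) n); last by rewrite size_mkseq.
by apply/mapP; exists alpha; rewrite // mem_filter ea.
Qed.

End Scale.

Lemma mkseq_prefix (f : nat -> nat) (x : nat -> nat) n :
  mkseq f n = mkseq x n -> forall i, (i < n)%N -> f i = x i.
Proof.
by move=> fx i i_n; move/(congr1 (fun t => nth 0 t i)): fx; rewrite !nth_mkseq.
Qed.

(** * Order-preserving compact covers *)

Section Covers.
Context (d : Order.disp_t) (W : orderType d) (hW : is_omega1 W).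
Context (K : (nat -> nat) -> set {ptws W -> bool}).
Context (Kcompact : forall f : nat -> nat, compact (K f)).
Context (Kcover : forall p : W -> bool, exists f, K f p).
Context (Kmono : forall f g : nat -> nat,
  (forall n : nat, (f n <= g n)%N) -> K f `<=` K g).

(** An enumeration, by a countable type, of the finite partial functions to
[bool] below [gamma]: a domain together with the coordinates of value [true]. *)
Definition pattern (gamma : W) : (seq nat * seq nat -> seq W * (W -> bool)) :=
  let E := projT1 (cid (segment_enumeration hW gamma)) in
  fun t => (map E t.1, fun alpha => alpha \in map E t.2).

Arguments pattern : simpl never.

Lemma patternP gamma (a : seq W) (e : W -> bool) :
  {in a, forall alpha, (alpha < gamma)%O} ->
  exists t, (pattern gamma t).1 = a /\ {in a, (pattern gamma t).2 =1 e}.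
Proof.
rewrite /pattern; case: cid => E /= EP.
have code (c : seq W) : {in c, forall alpha, (alpha < gamma)%O} ->
    exists i, map E i = c.
  elim: c => [_|alpha c IHc ac]; first by exists [::].
  have [x xc|i ic] := IHc; first by apply: ac; rewrite inE xc orbT.
  by have [n nE] := EP alpha (ac _ (mem_head _ _)); exists (n :: i); rewrite /= ic nE.
move=> ag; have [i ia] := code a ag.
have [x|i' ia'] := code [seq alpha <- a | e alpha].
  by rewrite mem_filter => /andP[_]; exact: ag.
exists (i, i'); split=> //= alpha aa; by rewrite ia' mem_filter aa andbT.
Qed.

(** The second hypothesis says that the dominating number exceeds omega_1. For
each [gamma] the function [phi gamma] dominates the search functions of the
countably many patterns below [gamma]; this reduces the patterns on omega_1 to
omega_1 many functions. A function [h] not dominated by any of them exceeds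
each search function at some argument [n], where one of the first [h n] points
taken from the n-th dense set realizes the pattern. *)
Lemma big_of_HFDw (X : W -> W -> bool) : HFDw X ->
  (forall g : W -> nat -> nat, exists h, forall gamma, ~ eventually_le h (g gamma)) ->
  exists f, big (K f).
Proof.
move=> hfd nodom.
have /choice[f fX] : forall xi, exists f, K f (X xi) by move=> xi; exact: Kcover.
pose A s := [set xi | mkseq (f xi) (size s) = s].
have [||x [_ xP]] := @tree_branch unit (fun s _ => ~ countable (A s))
  (fun _ _ => True) tt.
- have [_ nW _] := hW; have -> // : A [::] = [set: W].
  by apply/seteqP; split.
- move=> s _ nAs.
  have [|m nm] := @uncountable_piece d W nat (A s) (fun m xi => f xi (size s) = m) nAs.
    by move=> xi _; exists (f xi (size s)).
  exists m, tt => //; apply: contra_not nm; apply: sub_countable.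
  apply: subset_card_le => xi [fs fm].
  by rewrite /A /= size_rcons mkseqS fs fm.
have /choice[D DP] : forall n, exists D : (nat -> W) * W,
    (forall i, A (mkseq x n) (D.1 i)) /\
    forall (a : seq W) (e : W -> bool), {in a, forall alpha, (D.2 <= alpha)%O} ->
    exists i, {in a, X (D.1 i) =1 e}.
  move=> n; have [/hfd[s [delta h]] _] := xP n.
  by exists (s, delta).
have [delta Ddelta] := sequence_bounded hW (fun n => (D n).2).
have /choice[k kP] : forall t : (W * (seq nat * seq nat)) * nat, exists i,
    {in [seq alpha <- (pattern t.1.1 t.1.2).1 | (delta <= alpha)%O],
       X ((D t.2).1 i) =1 (pattern t.1.1 t.1.2).2}.
  move=> [[gamma t] n]; have [_] := DP n; apply=> alpha.
  by rewrite mem_filter => /andP[+ _]; apply: le_trans; exact/ltW.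
have /choice[phi phiP] : forall gamma, exists g,
    forall t, eventually_le (fun n => k ((gamma, t), n)) g.
  by move=> gamma; exact: countable_dominated.
have [h hP] := nodom phi.
have [|g gP] := @diagonal_bound x h (fun n i => f ((D n).1 i)).
  move=> n i j jn; have [/(_ i) + _] := DP n.
  by rewrite /A /= size_mkseq => /mkseq_prefix; apply.
exists g; apply: (@big_of_dense d W (K g) delta (@Kcompact g)) => a e ad.
have [gamma _ ag] := list_bounded hW delta a.
have [t [ta te]] := patternP e ag.
have [N Nphi] := phiP gamma t.
have [n Nn hn] : exists2 n, (N <= n)%N & (phi gamma n < h n)%N.
  apply: contrapT => no; apply: (hP gamma); exists N => n Nn.
  by rewrite leqNgt; apply/negP => ?; apply: no; exists n.
pose i := k ((gamma, t), n).
exists (X ((D n).1 i)).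
  apply: Kmono (fX _); apply: gP.
  by apply: leq_trans (ltnW hn); exact: Nphi.
have kPn := kP ((gamma, t), n); rewrite ta in kPn.
by move=> alpha aa; rewrite kPn ?te // mem_filter ad.
Qed.

(** A pair [(delta, z)] stands for the countable partial function [z|delta].
[meets s (delta, z)] says that K(s), the union of the [K f] with [f] extending
[s], is G_delta-dense in the set of all extensions of [z|delta]. *)
Definition meets (s : seq nat) (dz : W * (W -> bool)) : Prop :=
  forall gamma (w : W -> bool),
  (forall alpha, (alpha < dz.1)%O -> w alpha = dz.2 alpha) ->
  exists f p, [/\ mkseq f (size s) = s, K f p
    & forall alpha, (alpha < gamma)%O -> p alpha = w alpha].

Definition extends (dz dz' : W * (W -> bool)) : Prop :=
  (dz.1 <= dz'.1)%O /\ forall alpha, (alpha < dz.1)%O -> dz'.2 alpha = dz.2 alpha.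

Lemma extends_limit (dz : nat -> W * (W -> bool)) :
  (forall n, extends (dz n) (dz n.+1)) ->
  exists dw, forall n, extends (dz n) dw.
Proof.
move=> dzS; have [delta dP] := sequence_bounded hW (fun n => (dz n).1).
have [||w wP] := @coherent_limit d W (fun n => (dz n).1) (fun n => (dz n).2).
- by move=> n; have [] := dzS n.
- by move=> n; have [] := dzS n.
by exists (delta, w) => n; split; [exact/ltW|exact: wP].
Qed.

(** Otherwise one could extend [dz] successively so as to leave K(rcons s m) for
m = 0, 1, ...; the union of these extensions is still countable, and a point
of K(s) above it lies in one of the sets avoided. *)
Lemma meets_step s dz : meets s dz ->
  exists m, exists2 dz', meets (rcons s m) dz' & extends dz dz'.
Proof.
move=> ms; apply: contrapT => none.
have step m dz1 : extends dz dz1 -> exists2 dz2, extends dz dz2 &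
    extends dz1 dz2 /\ forall f p, mkseq f (size s).+1 = rcons s m -> K f p ->
      ~ forall alpha, (alpha < dz2.1)%O -> p alpha = dz2.2 alpha.
  move=> [d1 e1]; have nm : ~ meets (rcons s m) dz1.
    by move=> h; apply: none; exists m, dz1.
  have /existsNP[gamma /existsNP[w /not_implyP[w1 nw]]] := nm.
  have ew : extends dz1 (Order.max dz1.1 gamma, w).
    by split=> //=; rewrite le_max lexx.
  exists (Order.max dz1.1 gamma, w); split.
  - exact: le_trans d1 ew.1.
  - by move=> alpha ad /=; rewrite w1 ?e1 //; exact: lt_le_trans d1.
  - exact: ew.
  - move=> f p fs Kp pw; apply: nw; exists f, p; rewrite size_rcons; split=> //.
    by move=> alpha ag; apply: pw; rewrite /= lt_max ag orbT.
have [|u [u0 uI uR]] := iterated_choice (t0 := dz) _ step.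
  by split.
have [dw wP] := extends_limit (fun n => (uR n).1).
have [|f [p [fs Kp pw]]] := ms dw.1 dw.2.
  by move=> alpha ad; have [_] := wP 0; rewrite u0; apply.
have [_ h] := uR (f (size s)).
apply: (h f p) => //; first by rewrite mkseqS fs.
move=> alpha ad; have [le1 e1] := wP (f (size s)).+1.
by rewrite pw ?e1 //; exact: lt_le_trans le1.
Qed.

(** The hypothesis says that the bounding number exceeds omega_1. *)
Lemma big_of_bounded :
  (forall u : W -> nat -> nat, exists g, forall gamma, eventually_le (u gamma) g) ->
  exists f, big (K f).
Proof.
move=> bnd; have [_ nW _] := hW.
have [w0 _] : exists2 w0 : W, True & True.
  apply: contrapT => h; apply: nW; have -> : [set: W] = set0; last exact: countable0.
  by apply/seteqP; split=> // x _; apply: h; exists x.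
have [|x [u xP]] := @tree_branch _ meets extends (w0, xpredT) _ meets_step.
  by move=> gamma w _; have [f Kw] := Kcover w; exists f, w; split.
have [[delta z] zP] := extends_limit (fun n => (xP n).2).
(* [q] picks, in K(x|n), a point above [z|delta] with a given pattern on
   [[delta, gamma[]. *)
have /choice[q qP] : forall t : (W * (seq nat * seq nat)) * nat,
    exists fp : (nat -> nat) * (W -> bool), [/\ mkseq fp.1 t.2 = mkseq x t.2,
      K fp.1 fp.2 & {in [seq alpha <- (pattern t.1.1 t.1.2).1 | (delta <= alpha)%O],
        fp.2 =1 (pattern t.1.1 t.1.2).2}].
  move=> [[gamma t] n] /=.
  have [mx _] := xP n; have [/= le_n e_n] := zP n.
  have [g _ gP] := list_bounded hW delta (pattern gamma t).1.
  have [|f [p [fx Kp pw]]] := mx g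
    (fun alpha => if (alpha < delta)%O then z alpha else (pattern gamma t).2 alpha).
    by move=> alpha an; rewrite (lt_le_trans an le_n) e_n.
  exists (f, p); split=> //=; first by rewrite size_mkseq in fx.
  move=> alpha; rewrite mem_filter => /andP[da /gP/pw ->].
  by rewrite ltNge da.
have /choice[g gP] : forall gamma, exists g : nat -> nat, forall t,
    exists2 p, K g p & {in [seq alpha <- (pattern gamma t).1 | (delta <= alpha)%O],
        p =1 (pattern gamma t).2}.
  move=> gamma.
  pose code n := odflt ([::], [::]) (unpickle n : option (seq nat * seq nat)).
  have [|g gP] := @diagonal_bound x (fun=> 0) (fun n _ => (q ((gamma, code n), n)).1).
    move=> n _ i i_n; have [+ _ _] := qP ((gamma, code n), n).
    by move/mkseq_prefix; apply.
  exists g => t; have [_ Kp pt] := qP ((gamma, code (pickle t)), pickle t).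
  have ct : code (pickle t) = t by rewrite /code pickleK.
  rewrite ct /= in Kp pt; exists (q ((gamma, t), pickle t)).2 => //.
  by apply: Kmono Kp; have := gP (pickle t) 0 (leqnn _); rewrite ct.
have [h hP] := bnd g.
have [|m nm] := @uncountable_piece d W nat [set: W]
  (fun m gamma => forall n, (g gamma n <= h n + m)%N) nW.
  move=> gamma _; have [N gN] := hP gamma.
  exists (\max_(i < N) g gamma i) => n; have [Nn|nN] := leqP N n.
    by apply: leq_trans (gN n Nn) _; exact: leq_addr.
  by apply: leq_trans (leq_addl _ _); exact: (leq_bigmax (Ordinal nN)).
exists (fun n => (h n + m)%N); apply: (@big_of_dense _ _ _ delta); first exact: Kcompact.
move=> a e ad; have [g0 _ ag0] := list_bounded hW delta a.
have [gamma [_ gm] g0g] := uncountable_cofinal hW nm g0.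
have [|t [ta te]] := @patternP gamma a e.
  by move=> alpha /ag0 /lt_le_trans; apply.
have [p Kp pt] := gP gamma t; exists p; first exact: Kmono Kp.
rewrite ta in pt; by move=> alpha aa; rewrite pt ?te // mem_filter ad.
Qed.

(** A non-BIG compact set misses a finite pattern supported beyond any given
ordinal. Placing such patterns for [Y 0], [Y 1], ... one after the other
handles countably many sets at once within a bounded interval. *)
Lemma avoid_sequence (Y : nat -> set {ptws W -> bool}) :
  (forall n, compact (Y n)) -> (forall n, ~ big (Y n)) ->
  forall delta, exists delta' (w : W -> bool),
    (delta <= delta')%O /\ forall p : W -> bool,
    (forall alpha, (delta <= alpha < delta')%O -> p alpha = w alpha) ->
    forall n, ~ Y n p.
Proof.
move=> cY nY delta.
have step n dz : (delta <= dz.1)%O -> exists2 dz', (delta <= dz'.1)%O &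
    extends dz dz' /\ forall p : W -> bool,
      (forall alpha, (dz.1 <= alpha < dz'.1)%O -> p alpha = dz'.2 alpha) -> ~ Y n p.
  move=> dd.
  have [a [e [ad ae]]] : exists (a : seq W) (e : W -> bool),
      {in a, forall alpha, (dz.1 <= alpha)%O} /\
      forall p : W -> bool, {in a, p =1 e} -> ~ Y n p.
    apply: contrapT => no; apply: (nY n).
    apply: (@big_of_dense _ _ _ dz.1 (cY n)) => a e ad.
    apply: contrapT => nop; apply: no; exists a, e; split=> // p pe Yp.
    by apply: nop; exists p.
  have [g dg ag] := list_bounded hW dz.1 a.
  exists (g, fun alpha => if (alpha < dz.1)%O then dz.2 alpha else e alpha) => /=.
    by apply: le_trans dd _; exact: ltW.
  split; first by split=> /=; [exact: ltW|move=> alpha ->].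
  move=> p pw; apply: ae => alpha aa; rewrite pw ?ad ?ag //.
  by rewrite ltNge ad.
have [|u [u0 uI uR]] := @iterated_choice _ (fun dz => (delta <= dz.1)%O) _
  (delta, xpredT) _ step; first by [].
have [[delta' w] wP] := extends_limit (fun n => (uR n).1).
exists delta', w; split; first by have [/=] := wP 0; rewrite u0.
move=> p pw n; have [_] := uR n; apply=> alpha /andP[la ar].
have [le_n e_n] := wP n.+1; rewrite -e_n //; apply: pw.
by rewrite (le_trans (uI n) la) (lt_le_trans ar le_n).
Qed.

(** The hypothesis says that the dominating number is at most omega_1. The
family is dominating only modulo finite, so each [g gamma] is accompanied by
its translates [g gamma + m], which makes the avoided sets cofinal for the
pointwise order. *)
Lemma big_of_dominating (g : W -> nat -> nat) :
  (forall f, exists gamma, eventually_le f (g gamma)) -> exists f, big (K f).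
Proof.
move=> dom; apply: contrapT => /forallNP nbig.
have [w0 _] := dom id.
have avoid gamma := @avoid_sequence (fun m => K (fun n => (g gamma n + m)%N))
  (fun m => @Kcompact _) (fun m => nbig _).
have [gamma h|h hP] := @transfinite_choice d W hW (W * (W * (W -> bool)))
  (w0, (w0, xpredT))
  (fun gamma t => (t.1 <= t.2.1)%O /\ forall p : W -> bool,
    (forall alpha, (t.1 <= alpha < t.2.1)%O -> p alpha = t.2.2 alpha) ->
    forall m, ~ K (fun n => (g gamma n + m)%N) p)
  (fun t t' => (t.2.1 <= t'.1)%O).
  have [E EP] := segment_enumeration hW gamma.
  have [delta dP] := sequence_bounded hW (fun n => (h (E n)).2.1).
  have [delta' [w wP]] := avoid gamma delta.
  exists (delta, (delta', w)) => // alpha /EP[n <-]; exact/ltW.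
pose I alpha gamma := ((h gamma).1 <= alpha < (h gamma).2.1)%O.
have I_inj alpha gamma gamma' : I alpha gamma -> I alpha gamma' -> gamma = gamma'.
  wlog lt : gamma gamma' / (gamma < gamma')%O => [H|].
    by have [/H|/H + ? ?|] := ltgtP gamma gamma' => //; move=> ->.
  move=> /andP[_ a1] /andP[a2 _]; have [_ /(_ _ lt) hle] := hP gamma'.
  by have := lt_le_trans a1 (le_trans hle a2); rewrite ltxx.
pose p alpha := (h (xget w0 [set gamma | I alpha gamma])).2.2 alpha.
have pE gamma alpha : I alpha gamma -> p alpha = (h gamma).2.2 alpha.
  move=> Ia; rewrite /p; case: xgetP => [y _ Iy|/(_ gamma)//].
  by rewrite (I_inj _ _ _ Iy Ia).
have [f Kf] := Kcover p.
have [gamma [N fg]] := dom f.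
have [[_ no] _] := hP gamma.
apply: (no p (pE gamma) (\max_(i < N) f i)); apply: Kmono Kf => n.
have [/fg h1|nN] := leqP N n; first by apply: leq_trans h1 (leq_addr _ _).
by apply: leq_trans (leq_addl _ _); exact: (leq_bigmax (Ordinal nN)).
Qed.

End Covers.

Theorem lemma3 (d : Order.disp_t) (W : orderType d) (hW : is_omega1 W)
    (K : (nat -> nat) -> set {ptws W -> bool})
    (Kcompact : forall f : nat -> nat, compact (K f))
    (Kcover : \bigcup_(f in [set: nat -> nat]) K f = [set: {ptws W -> bool}])
    (Kmono : forall f g : nat -> nat,
        (forall n : nat, (f n <= g n)%N) -> K f `<=` K g) :
  exists f : nat -> nat, big (K f).
Proof.
have Kc (p : W -> bool) : exists f, K f p.
  have : [set: {ptws W -> bool}] p by [].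
  by rewrite -Kcover => -[f _ Kp]; exists f.
have [bnd|/existsNP[u /forallNP unb]] := pselect (forall u : W -> nat -> nat,
    exists g, forall gamma, eventually_le (u gamma) g).
  exact: (big_of_bounded hW).
have [[g dom]|nodom] := pselect (exists g : W -> nat -> nat,
    forall f, exists gamma, eventually_le f (g gamma)).
  exact: (big_of_dominating hW).
have [|b [bmono blt bunb]] := @unbounded_scale _ _ hW u.
  by move=> g; apply/existsNP/unb.
apply: (big_of_HFDw hW Kcompact Kc Kmono (X := osc_point b)).
  exact: (osc_point_HFDw hW).
move=> g; apply: contrapT => /forallNP h; apply: nodom; exists g => f.
by have /existsNP[gamma /contrapT] := h f; exists gamma.
Qed.
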